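(* Let $I=\sqrt{-1}$ and define $$f_{2a}=y^2+\tfrac{11}{5}xy-\tfrac{11}{5}y-\tfrac16x^2-\tfrac{28}{15}x+\tfrac{31}{30}+I\left(-\tfrac25xy+\tfrac25y-\tfrac16x^2+\tfrac{11}{15}x-\tfrac{17}{30}\right),$$ $$f_{3a}=\frac{\sqrt{-537594690-620415330\,I}}{443682000}\,(u+I v),$$ $$f_{2b}=y^2+\tfrac{11}{5}xy-\tfrac{11}{5}y-\tfrac16x^2-\tfrac{28}{15}x+\tfrac{31}{30}-I\left(-\tfrac25xy+\tfrac25y-\tfrac16x^2+\tfrac{11}{15}x-\tfrac{17}{30}\right),$$ $$f_{3b}=\frac{\sqrt{-537594690+620415330\,I}}{443682000}\,(u-I v),$$ where $$u=-14148y^3+7532-25008x+3925x^3-41895xy^2-21546x^2y+72522xy-36828y+12849x^2+42597y^2,$$ $$v=-24093x^2-18324+25497x^2y-29529y^2-74754xy+42696y+43956x+6561y^3+27990xy^2 .$$ Let $f_a:=f_{2a}^3+f_{3a}^2$, $f_b:=f_{2b}^3+f_{3b}^2$, and let $C_a,C_b\subset\mathbf P^2$ be the sextics $\{f_a=0\}$, $\{f_b=0\}$. Let $\varphi:\mathbf C[x,y]\to\mathbf C[x,y]$ be the Galois involution given by complex conjugation of the coefficients. Then $f_b=\varphi(f_a)$. Consequently the homeomorphism $\xi:\mathbf P^2\to\mathbf P^2$, $\xi(X,Y,Z)=(\bar X,\bar Y,\bar Z)$ (i.e. $\xi(x,y)=(\bar x,\bar y)$ in affine coordinates) gives a homeomorphism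 of pairs $\xi:(\mathbf P^2,C_a)\to(\mathbf P^2,C_b)$; in particular the complements $\mathbf P^2-C_a$ and $\mathbf P^2-C_b$ are homeomorphic.
   Context: $\mathbf P^2$ is the complex projective plane with homogeneous coordinates $X,Y,Z$ and affine coordinates $x=X/Z$, $y=Y/Z$; $\{f=0\}\subset\mathbf P^2$ means the projective closure, i.e. the zero set of the degree 6 homogenization. The choice of complex square roots in $f_{3a},f_{3b}$ is irrelevant since only $f_{3a}^2,f_{3b}^2$ enter. *)

(* Defs.v *)
(* For the binary literals of N_scope. *)
From Stdlib Require BinNatDef.
Export (notations) BinNatDef.
From HB Require Import structures.
From mathcomp Require Import all_boot all_order all_algebra.
From mathcomp Require Import complex generic_quotient.
From mathcomp Require Import all_classical all_reals.
From mathcomp Require Import topology normedtype.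
From mathcomp Require mpoly.

Set Implicit Arguments.
Unset Strict Implicit.
Unset Printing Implicit Defensive.

(* The notations of mpoly clash with those of mathcomp-analysis; the two that
   are needed are redeclared below. *)
Export -(notations) mpoly.

Import Order.TTheory GRing.Theory Num.Theory numFieldNormedType.Exports.

Local Open Scope ring_scope.
Local Open Scope classical_set_scope.
Local Open Scope complex_scope.
Local Open Scope quotient_scope.

Notation "{ 'mpoly' T [ n ] }" := (mpoly n T) : type_scope.
Notation "c %:MP" := (mpolyC _ c) : ring_scope.

(* R[i] with the topology of its modulus, as for an abstract numFieldType. *)
HB.instance Definition _ (R : realType) := NormedModule.copy R[i] R[i]^o.

Definition homeomorphism (T U : topologicalType) (f : T -> U) : Prop :=
  continuous f /\
  exists g : U -> T, [/\ cancel f g, cancel g f & continuous g].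

Definition homeomorphic (T U : topologicalType) : Prop :=
  exists f : T -> U, homeomorphism f.

Definition pair_homeomorphism (T U : topologicalType) (A : set T) (B : set U)
    (f : T -> U) : Prop :=
  homeomorphism f /\ f @` A = B.

Section ProjectivePlane.
Context {R : realType}.
Local Notation C := R[i].

(* C^3 \ 0, with the subspace topology that [set_type] carries. *)
Local Notation nonzero := [set v : 'rV[C]_3 | v != 0].
Local Notation nzvec := (set_type nonzero).

Definition proportional : rel nzvec := fun v w =>
  `[< exists2 c : C, c != 0 & val w = c *: val v >].

Lemma proportional_equiv : equiv_class_of proportional.
Proof.
split=> [v|v w|w v t].
- by apply/asboolP; exists 1; rewrite ?oner_neq0 ?scale1r.
- suff h a b : proportional a b -> proportional b a by apply/idP/idP; exact: h.
  move=> /asboolP[c c0 E]; apply/asboolP.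
  by exists c^-1; rewrite ?invr_eq0 // E scalerA mulVf // scale1r.
- move=> /asboolP[c c0 E] /asboolP[d d0 F]; apply/asboolP.
  by exists (d * c); rewrite ?mulf_neq0 // F E scalerA.
Qed.

Canonical proportional_equivrel := EquivRelPack proportional_equiv.

(* (C^3 \ 0) / C^*, with the quotient topology. *)
Local Notation P2 := (quotient_topology {eq_quot proportional}).

Definition homog_class (v : nzvec) : P2 := \pi_P2 v.

Lemma affine_vec_neq0 (x y : C) :
  \row_(i < 3) [:: x; y; 1]`_i \in nonzero.
Proof.
rewrite inE /=; apply/eqP => /rowP /(_ (inord 2)); rewrite !mxE inordK //=.
by move/eqP; rewrite oner_eq0.
Qed.

(* The point (x : y : 1). *)
Definition affine_point (x y : C) : P2 :=
  homog_class (exist (fun w => w \in nonzero) _ (affine_vec_neq0 x y)).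

Lemma conj_vec_neq0 (v : nzvec) :
  map_mx conjc (val v) \in nonzero.
Proof.
rewrite inE /=; have /set_mem /= := valP v; apply: contra => /eqP vE.
apply/eqP/rowP => i; move/rowP: vE => /(_ i); rewrite !mxE => /eqP.
by rewrite fmorph_eq0 => /eqP.
Qed.

Definition conj_vec (v : nzvec) : nzvec := exist (fun w => w \in nonzero) _ (conj_vec_neq0 v).

(* [repr] picks a representative; lemma xi_class shows that xi does not depend
   on it. *)
Definition xi (p : P2) : P2 := homog_class (conj_vec (repr p)).

Lemma homog_classP (v w : nzvec) :
  homog_class v = homog_class w <-> proportional v w.
Proof.
by split=> [/(@eqmodP _ proportional_equivrel v w)
           |/(@eqmodP _ proportional_equivrel v w)].
Qed.

Lemma xi_class (v : nzvec) : xi (homog_class v) = homog_class (conj_vec v).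
Proof.
apply/esym/homog_classP; have : proportional v (repr (homog_class v)).
  by apply/homog_classP; rewrite /homog_class reprK.
move=> /asboolP[c c0 E]; apply/asboolP; exists (conjc c); rewrite ?fmorph_eq0 //.
by rewrite /= E map_mxZ.
Qed.

(* Z^d f(X/Z, Y/Z), for f of degree at most d; the variables X, Y, Z are
   numbered 0, 1, 2, and x, y are numbered 0, 1. *)
Definition homogenize (d : nat) (f : {mpoly C[2]}) : {mpoly C[3]} :=
  \sum_(m <- msupp f)
    mcoeff m f *: (mpolyX C (mnm1 0) ^+ m 0 * mpolyX C (mnm1 1) ^+ m 1
                   * mpolyX C (mnm1 2) ^+ (d - mdeg m)).

Definition sextic (f : {mpoly C[2]}) : set P2 :=
  [set homog_class v | v in
    [set v : nzvec | meval (fun i => val v 0 i) (homogenize 6 f) = 0]].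

End ProjectivePlane.

Notation nzvec R := (set_type [set v : 'rV[R[i]]_3 | v != 0]).
Notation P2 R := (quotient_topology {eq_quot @proportional R}).

(* The number n, for a literal n stored in binary: [443682000%:R] would build a
   unary numeral. It is locked so that conversion does not build one either. *)
HB.lock Definition natC (R : realType) (n : BinNums.N) : R[i] :=
  (nat_of_bin n)%:R.
Arguments natC {R} n%_N_scope.

Section Sextics.
Context {R : realType}.
Local Notation C := R[i].

Definition phi (f : {mpoly C[2]}) : {mpoly C[2]} := map_mpoly conjc f.

Local Notation x := (mpolyX C (mnm1 (0 : 'I_2))).
Local Notation y := (mpolyX C (mnm1 (1 : 'I_2))).

Definition f2_re : {mpoly C[2]} :=
  y ^+ 2 + (11 / 5) *: (x * y) - (11 / 5) *: y - (1 / 6) *: x ^+ 2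
  - (28 / 15) *: x + (31 / 30)%:MP.

Definition f2_im : {mpoly C[2]} :=
  - (2 / 5) *: (x * y) + (2 / 5) *: y - (1 / 6) *: x ^+ 2
  + (11 / 15) *: x - (17 / 30)%:MP.

Definition f3_u : {mpoly C[2]} :=
  - natC 14148 *: y ^+ 3 + (natC 7532)%:MP - natC 25008 *: x
  + natC 3925 *: x ^+ 3 - natC 41895 *: (x * y ^+ 2)
  - natC 21546 *: (x ^+ 2 * y) + natC 72522 *: (x * y) - natC 36828 *: y
  + natC 12849 *: x ^+ 2 + natC 42597 *: y ^+ 2.

Definition f3_v : {mpoly C[2]} :=
  - natC 24093 *: x ^+ 2 - (natC 18324)%:MP + natC 25497 *: (x ^+ 2 * y)
  - natC 29529 *: y ^+ 2 - natC 74754 *: (x * y) + natC 42696 *: y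
  + natC 43956 *: x + natC 6561 *: y ^+ 3 + natC 27990 *: (x * y ^+ 2).

Definition f2a : {mpoly C[2]} := f2_re + 'i%C *: f2_im.
Definition f2b : {mpoly C[2]} := f2_re - 'i%C *: f2_im.

Definition radicand_a : C := - natC 537594690 - natC 620415330 * 'i%C.
Definition radicand_b : C := - natC 537594690 + natC 620415330 * 'i%C.

(* sa and sb are to be square roots of radicand_a and radicand_b. *)
Definition f3a (sa : C) : {mpoly C[2]} :=
  (sa / natC 443682000) *: (f3_u + 'i%C *: f3_v).
Definition f3b (sb : C) : {mpoly C[2]} :=
  (sb / natC 443682000) *: (f3_u - 'i%C *: f3_v).

Definition fa (sa : C) : {mpoly C[2]} := f2a ^+ 3 + f3a sa ^+ 2.
Definition fb (sb : C) : {mpoly C[2]} := f2b ^+ 3 + f3b sb ^+ 2.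

Definition Ca (sa : C) : set (P2 R) := sextic (fa sa).
Definition Cb (sb : C) : set (P2 R) := sextic (fb sb).

End Sextics.

(* Main.v *)
(* Conjugation fixes the real polynomials u, v and the real and imaginary parts
   of f_2a, and exchanges the radicands, so it maps f_a to f_b. Evaluating the
   conjugate polynomial at the conjugate point conjugates the value, hence xi
   maps C_a onto C_b; xi is a continuous involution because it is induced by an
   isometry of C in each coordinate. *)
Require Import Defs.
From mathcomp Require Import all_boot all_order all_algebra.
From mathcomp Require Import complex.
From mathcomp Require Import all_classical all_reals.
From mathcomp Require Import topology normedtype.
From mathcomp Require Import generic_quotient.

Import GRing.Theory Num.Theory numFieldNormedType.Exports.

Local Open Scope ring_scope.
Local Open Scope classical_set_scope.
Local Open Scope complex_scope.

(** * Continuity of isometries, entrywise maps and maps into subspaces *)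

(** By additivity, [f z - f w] has the norm of [z - w], so any radius [e] serves as its own
    modulus. *)
Lemma isometry_continuous (K : numFieldType) (V W : normedModType K)
    (f : {additive V -> W}) : (forall z, `|f z| = `|z|) -> continuous f.
Proof.
move=> norm_f z; apply/cvgrPdist_lt => e e0.
have /cvgrPdist_lt/(_ e e0) := @cvg_id _ (nbhs z).
by apply: filterS => w; rewrite -raddfB norm_f.
Qed.

Lemma conjc_continuous (R : realType) : continuous (@conjc R : R[i] -> R[i]).
Proof.
apply: (@isometry_continuous R[i] R[i] R[i] (@conjc R)) => -[a b].
by rewrite !normc_def /= sqrrN.
Qed.

Lemma map_mx_continuous (T U : topologicalType) (m n : nat) (f : T -> U) :
  continuous f -> continuous (map_mx f : 'M[T]_(m, n) -> 'M[U]_(m, n)).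
Proof.
(* A neighbourhood of a matrix contains a box of neighbourhoods [P i j] of its entries; the box is
   pulled back entry by entry. *)
move=> cf M A [P MP PA]; exists (fun i j => f @^-1` P i j) => [i j|N NP].
  by apply: cf; have := MP i j; rewrite mxE.
by apply: PA => i j; rewrite mxE; exact: NP.
Qed.

Lemma set_type_continuous (X T : topologicalType) (A : set T) (f : X -> A) :
  continuous (set_val \o f) -> continuous f.
Proof. exact: continuous_comp_initial. Qed.

Lemma set_val_continuous (T : topologicalType) (A : set T) :
  continuous (set_val : A -> T).
Proof. exact: initial_continuous. Qed.

Lemma pair_homeomorphism_setC (T U : topologicalType) (A : set T) (B : set U)
  (f : T -> U) : pair_homeomorphism A B f ->
  homeomorphic (~` A : set T) (~` B : set U).
Proof.
move=> [[cf [g [fK gK cg]]] fAB].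
have fC (p : (~` A : set T)) : f (val p) \in ~` B.
  apply/mem_set; rewrite -fAB => -[q Aq /(can_inj fK) qp].
  by have /set_mem := valP p; rewrite -qp.
have gC (q : (~` B : set U)) : g (val q) \in ~` A.
  apply/mem_set => Agq; have /set_mem := valP q; apply.
  have : (f @` A) (f (g (val q))) by exists (g (val q)).
  by rewrite gK fAB.
exists (fun p => exist (fun x => x \in ~` B) _ (fC p)); split.
  apply: set_type_continuous => p.
  exact: (continuous_comp (@set_val_continuous _ _ p) (cf _)).
exists (fun q => exist (fun x => x \in ~` A) _ (gC q)); split.
- by move=> p; apply: val_inj; exact: fK.
- by move=> q; apply: val_inj; exact: gK.
- apply: set_type_continuous => q.
  exact: (continuous_comp (@set_val_continuous _ _ q) (cg _)).
Qed.

(** * Conjugation on the projective plane *)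

Lemma conj_vecK (R : realType) : involutive (@conj_vec R).
Proof.
move=> v; apply: val_inj; apply/rowP => i.
by rewrite /= !mxE conjcK.
Qed.

Lemma conj_vec_continuous (R : realType) : continuous (@conj_vec R).
Proof.
apply: set_type_continuous => v.
apply: (continuous_comp (@set_val_continuous _ _ v)).
exact: (map_mx_continuous _ _ _ _ _ (@conjc_continuous R)).
Qed.

Lemma homog_class_surj (R : realType) (p : P2 R) :
  exists v, p = homog_class v.
Proof. by exists (repr p); rewrite /homog_class reprK. Qed.

Lemma xiK (R : realType) : involutive (@xi R).
Proof.
by move=> p; have [v ->] := homog_class_surj R p; rewrite !xi_class conj_vecK.
Qed.

Lemma xi_continuous (R : realType) : continuous (@xi R).
Proof.
(* By the universal property of the quotient topology, it suffices to treat [xi] after the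
   projection, where it lifts to [conj_vec]. *)
apply/quotient_continuous.
rewrite (_ : _ \o _ = @homog_class R \o @conj_vec R).
  move=> v; apply: (continuous_comp (@conj_vec_continuous R v)).
  exact: pi_continuous.
by apply/funext => v; exact: xi_class.
Qed.

Lemma xi_homeomorphism (R : realType) : homeomorphism (@xi R).
Proof.
split; first exact: xi_continuous.
by exists (@xi R); split; [exact: xiK | exact: xiK | exact: xi_continuous].
Qed.

(** * Zero sets under conjugation of the coefficients *)

Lemma meval_map_mpoly (n : nat) (A B : comNzRingType) (h : {rmorphism A -> B})
    (v : 'I_n -> A) (p : {mpoly A[n]}) :
  meval (h \o v) (map_mpoly h p) = h (meval v p).
Proof.
elim/mpolyind: p => [|c m p _ _ IH]; first by rewrite !rmorph0.
rewrite !rmorphD /= IH map_mpolyZ map_mpolyX !mevalZ !mevalX !rmorphM rmorph_prod.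
by congr (_ * _ + _); apply: eq_bigr => i _; rewrite rmorphXn.
Qed.

Lemma homogenize_phi (R : realType) (d : nat) (f : {mpoly R[i][2]}) :
  homogenize d (phi f) = map_mpoly conjc (homogenize d f).
Proof.
(* Conjugation is injective and kills no coefficient, so both supports agree up to order and the
   sums can be compared termwise. *)
rewrite /homogenize (perm_big _ (msupp_map_mpoly _ (fmorph_inj _))) /=.
rewrite rmorph_sum /=; apply: eq_bigr => m _.
by rewrite mcoeff_map_mpoly map_mpolyZ !rmorphM !rmorphXn /= !map_mpolyX.
Qed.

Lemma xi_sextic (R : realType) (f : {mpoly R[i][2]}) :
  @xi R @` sextic f = sextic (phi f).
Proof.
have zero_conj (v : nzvec R) :
    meval (fun i => val (conj_vec v) 0 i) (homogenize 6 (phi f)) =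
    (meval (fun i => val v 0 i) (homogenize 6 f))^*.
  rewrite homogenize_phi -meval_map_mpoly.
  by apply: meval_eq => i; rewrite /= mxE.
apply/seteqP; split=> [_ [_ [v v0 <-] <-]|_ [v v0 <-]].
  exists (conj_vec v); last by rewrite xi_class.
  by rewrite /= zero_conj v0 rmorph0.
exists (homog_class (conj_vec v)); last by rewrite xi_class conj_vecK.
(* As [conj_vec] is involutive, this expresses the value of the conjugate form at [v] as the
   conjugate of the value of the original form at [conj_vec v]. *)
exists (conj_vec v) => //; have := zero_conj (conj_vec v).
by rewrite conj_vecK v0 => /esym/eqP; rewrite fmorph_eq0 => /eqP.
Qed.

(** * Real coefficients and the conjugate equations *)

Lemma conjc_natC (R : realType) (n : BinNums.N) :
  conjc (natC n : R[i]) = natC n.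
Proof. by rewrite natC.unlock rmorph_nat. Qed.

Lemma conjc_i (R : realType) : conjc 'i%C = - 'i%C :> R[i].
Proof. by apply/eqP; rewrite eq_complex /= oppr0 !eqxx. Qed.

Lemma conjc_frac (R : realType) (m n : nat) :
  conjc (m%:R / n%:R : R[i]) = m%:R / n%:R.
Proof. by rewrite fmorph_div !rmorph_nat. Qed.

Section RealPolynomials.
Variable R : realType.
Implicit Types (p q : {mpoly R[i][2]}) (c : R[i]).

Lemma phiD p q : phi (p + q) = phi p + phi q.
Proof. exact: rmorphD. Qed.

Lemma phiXn p n : phi (p ^+ n) = phi p ^+ n.
Proof. exact: rmorphXn. Qed.

Lemma phiZ c p : phi (c *: p) = conjc c *: phi p.
Proof. exact: map_mpolyZ. Qed.

Definition real_mpoly p := phi p = p.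

Lemma real_mpolyD p q : real_mpoly p -> real_mpoly q -> real_mpoly (p + q).
Proof. by rewrite /real_mpoly phiD => -> ->. Qed.

Lemma real_mpolyN p : real_mpoly p -> real_mpoly (- p).
Proof. by rewrite /real_mpoly /phi rmorphN /= => ->. Qed.

Lemma real_mpolyM p q : real_mpoly p -> real_mpoly q -> real_mpoly (p * q).
Proof. by rewrite /real_mpoly /phi rmorphM /= => -> ->. Qed.

Lemma real_mpolyXn p n : real_mpoly p -> real_mpoly (p ^+ n).
Proof. by rewrite /real_mpoly phiXn => ->. Qed.

Lemma real_mpolyZ c p : conjc c = c -> real_mpoly p -> real_mpoly (c *: p).
Proof. by rewrite /real_mpoly phiZ => -> ->. Qed.

Lemma real_mpolyC c : conjc c = c -> real_mpoly c%:MP.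
Proof. by rewrite /real_mpoly /phi map_mpolyC /= => ->. Qed.

Lemma real_mpolyX m : real_mpoly (mpolyX R[i] m).
Proof. exact: map_mpolyX. Qed.

Lemma conjcN_real c : conjc c = c -> conjc (- c) = - c.
Proof. by rewrite rmorphN /= => ->. Qed.

End RealPolynomials.

(* Rewriting with the morphism lemmas of [phi] would unify sums with products
   and scalings by unfolding the operations of {mpoly _}, which diverges: the
   rule is selected on the head symbol instead. *)
Ltac real_mpoly_step :=
  lazymatch goal with
  | |- real_mpoly _ (_ + _) => apply: real_mpolyD
  | |- real_mpoly _ (- _) => apply: real_mpolyN
  | |- real_mpoly _ (_ * _) => apply: real_mpolyM
  | |- real_mpoly _ (_ ^+ _) => apply: real_mpolyXn
  | |- real_mpoly _ (_ *: _) => apply: real_mpolyZ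
  | |- real_mpoly _ (_%:MP) => apply: real_mpolyC
  | |- real_mpoly _ (mpolyX _ _) => exact: real_mpolyX
  | |- conjc (- _) = _ => apply: conjcN_real
  | |- conjc (natC _) = _ => exact: conjc_natC
  | |- conjc (_ / _) = _ => exact: conjc_frac
  end.

Lemma f2_re_real (R : realType) : real_mpoly R f2_re.
(* The loop stops at the coefficient [1 / 6]: its numerator is [1], not visibly a cast [m%:R], so
   the instance is given explicitly. *)
Proof. by rewrite /f2_re; repeat real_mpoly_step; exact: (conjc_frac R 1 6). Qed.

Lemma f2_im_real (R : realType) : real_mpoly R f2_im.
Proof. by rewrite /f2_im; repeat real_mpoly_step; exact: (conjc_frac R 1 6). Qed.

Lemma f3_u_real (R : realType) : real_mpoly R f3_u.
Proof. by rewrite /f3_u; repeat real_mpoly_step. Qed.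

Lemma f3_v_real (R : realType) : real_mpoly R f3_v.
Proof. by rewrite /f3_v; repeat real_mpoly_step. Qed.

Lemma phi_addi (R : realType) (p q : {mpoly R[i][2]}) :
  real_mpoly R p -> real_mpoly R q -> phi (p + 'i%C *: q) = p - 'i%C *: q.
Proof.
by rewrite /real_mpoly phiD phiZ conjc_i scaleNr => -> ->.
Qed.

Lemma fb_phi (R : realType) (sa sb : R[i]) :
  sa ^+ 2 = radicand_a -> sb ^+ 2 = radicand_b -> fb sb = phi (fa sa).
Proof.
move=> hsa hsb.
have radicand_conj : radicand_b = conjc (radicand_a : R[i]).
  have conj_addi (c d : R[i]) : conjc (c - d * 'i%C) = conjc c + conjc d * 'i%C.
    (* On the right, ['i] is written as [- - 'i], that is, minus the conjugate of ['i]. *)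
    by rewrite rmorphB rmorphM -[X in _ + _ * X]opprK -conjc_i mulrN.
  by rewrite conj_addi conjcN_real conjc_natC.
have phi_f2a : phi f2a = f2b :> {mpoly R[i][2]}.
  exact: phi_addi (f2_re_real R) (f2_im_real R).
have phi_f3 := phi_addi R _ _ (f3_u_real R) (f3_v_real R).
(* The roots [sa] and [sb] enter only through their squares, so their choice does not matter: the
   conjugate radicands replace them. *)
rewrite /fb /fa /f3a /f3b !exprZn !expr_div_n hsa hsb radicand_conj.
rewrite phiD phiZ 2!phiXn phi_f2a phi_f3.
by rewrite fmorph_div rmorphXn /= conjc_natC.
Qed.

Theorem proposition19 (R : realType) (sa sb : R[i])
    (hsa : sa ^+ 2 = radicand_a) (hsb : sb ^+ 2 = radicand_b) :
  [/\ fb sb = phi (fa sa),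
      (forall v : nzvec R, xi (homog_class v) = homog_class (conj_vec v)),
      (forall x y : R[i], xi (affine_point x y) = affine_point x^* y^*),
      pair_homeomorphism (Ca sa) (Cb sb) (@xi R) &
      homeomorphic (~` Ca sa : set (P2 R)) (~` Cb sb : set (P2 R))].
Proof.
have fbE := fb_phi R sa sb hsa hsb.
have xi_pair : pair_homeomorphism (Ca sa) (Cb sb) (@xi R).
  by split; [exact: xi_homeomorphism | rewrite /Ca /Cb fbE xi_sextic].
split=> //.
- exact: xi_class.
- move=> x y; rewrite /affine_point xi_class; congr homog_class.
  apply: val_inj; apply/rowP => i; rewrite /= !mxE.
  (* Only the third coordinate remains, the constant 1, which conjugation fixes. *)
  by case: i => [[|[|[|]]] ?] //; exact: conjc1.
- exact: pair_homeomorphism_setC xi_pair.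
Qed.
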